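(* Let $N,M\ge 1$ be integers, let $\bm{A}_{\mathrm{intra}}\in\mathbb{R}^{N\times N}$ and $\bm{A}_{\mathrm{inter}}\in\mathbb{R}^{M\times M}$ have zero diagonal, and let $\omega_{\mathrm{intra}},\omega_{\mathrm{inter}}\in\mathbb{R}$. Let $\bm{\psi}^*\in\mathbb{R}^N$ be an equilibrium point of the intra-layer system $$\frac{d\psi_i}{dt}=\omega_{\mathrm{intra}}+\sum_{j=1}^{N}(\bm{A}_{\mathrm{intra}})_{ij}\sin(\psi_j-\psi_i),\qquad 1\le i\le N,$$ let $\bm{\phi}^*\in\mathbb{R}^M$ be an equilibrium point of the inter-layer system $$\frac{d\phi_l}{dt}=\omega_{\mathrm{inter}}+\sum_{k=1}^{M}(\bm{A}_{\mathrm{inter}})_{lk}\sin(\phi_k-\phi_l),\qquad 1\le l\le M,$$ and let $\bm{\theta}^*\in\mathbb{R}^{NM}$, $\theta^*_{N(l-1)+i}=\psi_i^*+\phi_l^*$ ($1\le l\le M$, $1\le i\le N$), be the composed equilibrium point of the multiplex system $$\frac{d\theta_i}{dt}=(\omega_{\mathrm{inter}}+\omega_{\mathrm{intra}})+\sum_{j=1}^{NM}\bm{K}_{ij}\sin(\theta_j-\theta_i),\qquad \bm{K}=\bm{A}_{\mathrm{intra}}\bigoplus\bm{A}_{\mathrm{inter}}.$$ Then $\bm{\theta}^*$ is linearly stable for the multiplex system if and only if $\bm{\psi}^*$ is linearly stable for the intra-layer system and $\bm{\phi}^*$ is linearly stable for the inter-layer system.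
   Context: An equilibrium point of one of these systems is called linearly stable if the Jacobian matrix of the right-hand side at that point has $0$ as an eigenvalue of (algebraic) multiplicity $1$ and all its other eigenvalues have negative real part (i.e. are negative, when the Jacobian is symmetric). The eigenvalue $0$ is always present, since the rows of the Jacobian sum to zero. Explicitly, for the system $\dot x_i=\omega+\sum_j \bm{B}_{ij}\sin(x_j-x_i)$ with $\bm{B}\in\mathbb{R}^{n\times n}$ of zero diagonal, the Jacobian at $\bm{x}$ has entries $\bm{B}_{ij}\cos(x_j-x_i)$ for $i\ne j$ and $-\sum_{j\ne i}\bm{B}_{ij}\cos(x_j-x_i)$ on the diagonal. Kronecker product convention: for $\bm{A}\in\mathbb{R}^{p\times q}$ and $\bm{B}=[b_{ij}]\in\mathbb{R}^{r\times s}$, $\bm{A}\otimes\bm{B}$ is the block matrix whose $(i,j)$ block is $\bm{A}b_{ij}$. For $\bm{A}\in\mathbb{R}^{r\times r}$, $\bm{B}\in\mathbb{R}^{s\times s}$, the Kronecker sum is $\bm{A}\bigoplus\bm{B}=\bm{A}\otimes\bm{I}_s+\bm{I}_r\otimes\bm{B}$, with $\bm{I}_k$ the $k\times k$ identity. Hence $\bm{K}$ has $M\times M$ blocks of size $N\times N$, with diagonal blocks $\bm{A}_{\mathrm{intra}}$ and $(l,k)$ block $(\bm{A}_{\mathrm{inter}})_{lk}\bm{I}_N$ for $l\ne k$. *)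

(* Defs.v *)
From HB Require Import structures.
From mathcomp Require Import all_boot all_order all_algebra.
From mathcomp Require Import boolp classical_sets functions reals topology.
From mathcomp Require Import normedtype derive realfun trigo.
From mathcomp.real_closed Require Import complex mxtens.

Set Implicit Arguments.
Unset Strict Implicit.
Unset Printing Implicit Defensive.

Import Order.TTheory GRing.Theory Num.Theory.
Import numFieldNormedType.Exports.
Local Open Scope ring_scope.

Definition oscillator_field (R : realType) (n : nat) (omega : R) (B : 'M[R]_n)
    (x : 'rV[R]_n) : 'rV[R]_n :=
  \row_i (omega + \sum_j B i j * sin (x 0 j - x 0 i)).

Definition equilibrium (R : realType) (n : nat) (f : 'rV[R]_n -> 'rV[R]_n)
    (x : 'rV[R]_n) : Prop :=
  f x = 0.

(* ['J f x] acts on row vectors by right multiplication, hence the transpose: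
   entry (i, j) below is the partial derivative of f_i with respect to x_j. *)
Definition jacobian_matrix (R : realType) (n : nat)
    (f : 'rV[R]_n -> 'rV[R]_n) (x : 'rV[R]_n) : 'M[R]_n :=
  ('J f x)^T.

(* Linear stability is a property of equilibria, so it includes [equilibrium].
   The Jacobian need not be symmetric: its spectrum is taken over R[i].
   [mup 0 (char_poly J)] is the algebraic multiplicity of the eigenvalue 0. *)
Definition linearly_stable (R : realType) (n : nat)
    (f : 'rV[R]_n -> 'rV[R]_n) (x : 'rV[R]_n) : Prop :=
  let J : 'M[R[i]]_n := map_mx (real_complex R) (jacobian_matrix f x) in
  [/\ equilibrium f x,
      mup 0 (char_poly J) = 1%N
    & forall z : R[i], eigenvalue J z -> z != 0 -> complex.Re z < 0].

(* Block (i, j) of the Kronecker product of A and B is here A scaled by B_ij;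
   [tensmx A B] follows the opposite convention (B scaled by A_ij). *)
Definition kronecker_product (R : realType) (p q r s : nat)
    (A : 'M[R]_(p, q)) (B : 'M[R]_(r, s)) : 'M[R]_(r * p, s * q) :=
  tensmx B A.

Definition kronecker_sum (R : realType) (r s : nat)
    (A : 'M[R]_r) (B : 'M[R]_s) : 'M[R]_(s * r) :=
  kronecker_product A (1%:M : 'M[R]_s) + kronecker_product (1%:M : 'M[R]_r) B.

(* [mxtens_unindex] sends the 0-based index N * l + i to (l, i). *)
Definition compose_state (R : realType) (N M : nat)
    (psi : 'rV[R]_N) (phi : 'rV[R]_M) : 'rV[R]_(M * N) :=
  \row_a (psi 0 (mxtens_unindex a).2 + phi 0 (mxtens_unindex a).1).

Lemma compose_stateE (R : realType) (N M : nat) (psi : 'rV[R]_N)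
    (phi : 'rV[R]_M) (a : 'I_(M * N)) (l : 'I_M) (i : 'I_N) :
  a = (N * l + i)%N :> nat -> compose_state psi phi 0 a = psi 0 i + phi 0 l.
Proof.
move=> aE; have -> : a = mxtens_index (l, i).
  by apply: val_inj => /=; rewrite aE mulnC.
by rewrite mxE mxtens_indexK.
Qed.

Lemma kronecker_sumE (R : realType) (r s : nat) (A : 'M[R]_r) (B : 'M[R]_s)
    (l k : 'I_s) (i j : 'I_r) :
  kronecker_sum A B (mxtens_index (l, i)) (mxtens_index (k, j)) =
  A i j *+ (l == k) + B l k *+ (i == j).
Proof.
by rewrite mxE !tensmxE !mxE mulr_natl mulr_natr.
Qed.

Lemma jacobian_matrix_oscillator_field (R : realType) (n : nat) (omega : R)
    (B : 'M[R]_n) (x : 'rV[R]_n) (i j : 'I_n) :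
  jacobian_matrix (oscillator_field omega B) x i j =
  if i == j then - \sum_(k | k != i) B i k * cos (x 0 k - x 0 i)
  else B i j * cos (x 0 j - x 0 i).
Proof.
pose u (k l : 'I_n) (y : 'rV[R]_n) : R := y 0 k - y 0 l.
have du (k l : 'I_n) : differentiable (u k l) x.
  by apply: differentiableB; exact: differentiable_coord.
have dsin (k l : 'I_n) : differentiable (sin \o u k l) x.
  by apply: differentiable_comp => //; exact/derivable1_diffP.
pose g (l : 'I_n) : 'rV[R]_n -> R :=
  cst omega + \sum_(k < n) B l k *: (sin \o u k l).
have gE l : (fun y => oscillator_field omega B y 0 l) = g l.
  apply/funext => y; rewrite /g mxE fctE /=; congr (_ + _).
  by rewrite fct_sumE; apply: eq_bigr.
have dg l : differentiable (g l) x.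
  apply: differentiableD => //; apply: differentiable_sum => k.
  exact: differentiableZ.
have df : differentiable (oscillator_field omega B) x.
  have -> : oscillator_field omega B =
      \sum_(l < n) (fun y => g l y *: delta_mx 0 l).
    apply/funext => y; rewrite fct_sumE [LHS]row_sum_delta.
    by apply: eq_bigr => l _; rewrite -gE.
  by apply: differentiable_sum => l; exact: differentiableZl.
have -> : jacobian_matrix (oscillator_field omega B) x i j =
    'D_(delta_mx 0 j) (g i) x.
  rewrite mxE -[in RHS]gE.
  transitivity (((delta_mx 0 j : 'rV[R]_n) *m jacobian (oscillator_field omega B) x) 0 i).
    by rewrite -rowE [RHS]mxE.
  rewrite -deriveEjacobian // derive_mx ?mxE //.
  exact: diff_derivable.
have Dcoord (k : 'I_n) v : 'D_v (fun y : 'rV[R]_n => y 0 k : R) x = v 0 k.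
  have := @derive_id _ _ x v; rewrite derive_mx; last exact: derivable_id.
  by move/matrixP/(_ 0 k); rewrite mxE.
have Du (k : 'I_n) v : 'D_v (u k i) x = u k i v.
  rewrite deriveB ?Dcoord //;
    exact/diff_derivable/differentiable_coord.
have Ds (k : 'I_n) v : 'D_v (sin \o u k i) x = cos (u k i x) * u k i v.
  rewrite deriveE // diff_comp //; last exact/derivable1_diffP.
  rewrite /= deriv1E // -deriveE // Du derive1E derive_val.
  exact: mulrC.
rewrite /g deriveD; [|exact: diff_derivable|]; last first.
  apply: diff_derivable; apply: differentiable_sum => k.
  exact: differentiableZ.
rewrite derive_cst add0r derive_sum; last first.
  by move=> k; apply: diff_derivable; exact: differentiableZ.
transitivity (\sum_k B i k * (cos (u k i x) * u k i (delta_mx 0 j))).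
  apply: eq_bigr => k _; rewrite -Ds deriveZ //.
  exact: diff_derivable.
rewrite /u; case: eqVneq => [<-|ij].
  rewrite (bigD1 i) //= !subrr !mulr0 add0r -sumrN.
  apply: eq_bigr => k ki.
  by rewrite !mxE !eqxx /= (negbTE ki) sub0r mulrN1 mulrN.
rewrite (bigD1 j) //= big1 ?addr0 => [|k kj].
  by rewrite !mxE !eqxx /= (negbTE ij) subr0 mulr1.
by rewrite !mxE /= (negbTE kj) (negbTE ij) subr0 !mulr0.
Qed.

(* Main.v *)
Require Import Defs.
From HB Require Import structures.
From mathcomp Require Import all_boot all_order all_algebra.
From mathcomp Require Import reals trigo.
From mathcomp.real_closed Require Import complex mxtens.

Set Implicit Arguments.
Unset Strict Implicit.
Unset Printing Implicit Defensive.

Import Order.TTheory GRing.Theory Num.Theory.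
Local Open Scope ring_scope.

(** The Jacobian of the multiplex system at the composed state is the Kronecker
    sum of the Jacobians of the two layers
    ([jacobian_matrix_kronecker_sum]): a coupling of the multiplex acts either
    inside a layer, where the phases of [phi] cancel, or between two copies of
    one node, where those of [psi] cancel. Hence its eigenvalues, counted with
    multiplicity, are the sums [a i + b l] of an eigenvalue of the intra-layer
    Jacobian and one of the inter-layer Jacobian
    ([char_poly_tens_sum_split]).

    Linear stability of an equilibrium says that exactly one eigenvalue in the
    list vanishes and that all others have negative real part
    ([stable_char_polyP]). Since the rows of a Jacobian sum to zero, some [a i0]
    and some [b l0] vanish, so both lists occur inside the list of sums, as
    [a i + b l0] and [a i0 + b l]; stability of the multiplex therefore passes
    to the layers. Conversely, if [a i0] and [b l0] are the only eigenvalues of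
    nonnegative real part, then [a i + b l] has negative real part unless
    [(i, l)] is [(i0, l0)] ([sum_one_zero_others_negP]). *)

(** * Characteristic polynomial of a Kronecker sum *)

Lemma char_poly_similar (R : comUnitRingType) (n : nat) (P A B : 'M[R]_n) :
  P \in unitmx -> P *m A = B *m P -> char_poly A = char_poly B.
Proof.
move=> Pu PA; pose Q := map_mx (@polyC R) P.
have detQ : \det Q * \det (map_mx (@polyC R) (invmx P)) = 1.
  by rewrite -det_mulmx -map_mxM mulmxV // map_mx1 det1.
have QA : Q *m char_poly_mx A = char_poly_mx B *m Q.
  rewrite /char_poly_mx mulmxBr mulmxBl -!map_mxM PA; congr (_ - _).
  by rewrite scalar_mxC.
have := congr1 determinant QA; rewrite !det_mulmx => detQA.
rewrite /char_poly -[LHS]mul1r -detQ mulrAC detQA -mulrA detQ.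
by rewrite mulr1.
Qed.

Lemma exists_similar_trig (C : numClosedFieldType) (n : nat) (A : 'M[C]_n) :
  (0 < n)%N ->
  exists P T : 'M[C]_n, [/\ P \in unitmx, is_trig_mx T & P *m A = T *m P].
Proof.
move=> n_gt0; have [P Puni Ptrig] := Schur A n_gt0.
have Pu := unitarymx_unit Puni.
by exists P, (conjmx P A); split=> //; rewrite conjumx // mulmxKV.
Qed.

(** Index [(l, i)] comes before [(k, j)] in the order of ['I_(m * n)] exactly
    when it does lexicographically, so that the Kronecker sum of two lower
    triangular matrices is lower triangular. *)
Lemma tens_sum_trig (R : pzRingType) (m n : nat) (T : 'M[R]_n) (S : 'M[R]_m) :
  is_trig_mx T -> is_trig_mx S ->
  is_trig_mx (tensmx S 1%:M + tensmx 1%:M T).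
Proof.
move=> /is_trig_mxP T0 /is_trig_mxP S0; apply/is_trig_mxP => x y.
case: (mxtens_indexP x) => l i; case: (mxtens_indexP y) => k j lt_xy.
rewrite mxE !tensmxE !mxE.
have [lt_lk|lt_kl|/val_inj eq_lk] := ltngtP l k.
- by rewrite S0 // -[l == k]val_eqE /= (ltn_eqF lt_lk) !mul0r addr0.
- suff : (k * n + j <= l * n + i)%N by rewrite leqNgt lt_xy.
  apply: leq_trans (leq_addr _ _); apply: (@leq_trans (k.+1 * n)).
    by rewrite mulSn addnC leq_add2r ltnW.
  by rewrite leq_mul2r lt_kl orbT.
- have lt_ij : (i < j)%N by move: lt_xy; rewrite /= eq_lk ltn_add2l.
  by rewrite T0 // -[i == j]val_eqE /= (ltn_eqF lt_ij) !mulr0 addr0.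
Qed.

(** If [P] and [Q] triangularize [B] and [A], then [tensmx P Q] triangularizes
    their Kronecker sum, and the diagonal of the result consists of the sums of
    the diagonal entries. *)
Lemma char_poly_tens_sum_split (C : numClosedFieldType) (m n : nat)
    (A : 'M[C]_n) (B : 'M[C]_m) :
  (0 < n)%N -> (0 < m)%N ->
  exists (a : 'I_n -> C) (b : 'I_m -> C),
  [/\ char_poly A = \prod_i ('X - (a i)%:P),
      char_poly B = \prod_l ('X - (b l)%:P)
    & char_poly (tensmx B 1%:M + tensmx 1%:M A) =
      \prod_(p : 'I_n * 'I_m) ('X - (a p.1 + b p.2)%:P)].
Proof.
move=> n_gt0 m_gt0.
have [Q [T [Qu Ttrig QA]]] := exists_similar_trig A n_gt0.
have [P [S [Pu Strig PB]]] := exists_similar_trig B m_gt0.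
exists (fun i => T i i), (fun l => S l l); split.
- by rewrite (char_poly_similar Qu QA) char_poly_trig.
- by rewrite (char_poly_similar Pu PB) char_poly_trig.
have PQ : tensmx P Q *m (tensmx B 1%:M + tensmx 1%:M A) =
          (tensmx S 1%:M + tensmx 1%:M T) *m tensmx P Q.
  by rewrite mulmxDr mulmxDl !tensmx_mul !mulmx1 !mul1mx PB QA.
have PQu : tensmx P Q \in unitmx by apply: tensmx_unit; rewrite -?lt0n.
rewrite (char_poly_similar PQu PQ).
rewrite char_poly_trig; last exact: tens_sum_trig.
rewrite (reindex (fun p : 'I_n * 'I_m => mxtens_index (p.2, p.1))) /=.
  apply: eq_bigr => -[i l] _; rewrite mxE !tensmxE !mxE !eqxx mulr1 mul1r.
  by rewrite addrC.
exists (fun x => ((mxtens_unindex x).2, (mxtens_unindex x).1)) => [[i l]|x] _.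
  by rewrite mxtens_indexK.
by rewrite -surjective_pairing mxtens_unindexK.
Qed.

(** * Stability in terms of a list of eigenvalues *)

Definition one_zero_others_neg (R : realType) (I : finType) (d : I -> R[i]) :
    Prop :=
  exists2 i0, d i0 = 0 & forall i, i != i0 -> complex.Re (d i) < 0.

Lemma stable_char_polyP (R : realType) (n : nat) (J : 'M[R[i]]_n)
    (I : finType) (d : I -> R[i]) :
  char_poly J = \prod_i ('X - (d i)%:P) ->
  (mup 0 (char_poly J) = 1%N /\
   forall z, eigenvalue J z -> z != 0 -> complex.Re z < 0) <->
  one_zero_others_neg d.
Proof.
move=> JE.
have prodE : char_poly J = \prod_(z <- [seq d i | i : I]) ('X - z%:P).
  by rewrite JE big_map big_enum.
have eigE z : eigenvalue J z = (z \in [seq d i | i : I]).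
  by rewrite eigenvalue_root_char prodE root_prod_XsubC.
have mupE : mup 0 (char_poly J) = #|[pred i | d i == 0]|.
  rewrite prodE mu_prod_XsubC count_map cardE size_filter.
  by rewrite enumT; apply: eq_count => i.
rewrite mupE; split=> [[/eqP/card1P[i0 i0P] neg]|[i0 di0 neg]].
  exists i0 => [|i ii0]; first by apply/eqP; have := i0P i0; rewrite !inE eqxx.
  by apply: neg; [rewrite eigE image_f|have := i0P i; rewrite !inE => ->].
split=> [|z]; last first.
  rewrite eigE => /mapP[i _ ->]; have [->|/neg //] := eqVneq i i0.
  by rewrite di0 eqxx.
apply/eqP/card1P; exists i0 => i; rewrite !inE.
have [->|/neg] := eqVneq i i0; first by rewrite di0 eqxx.
by apply: contraTF => /eqP ->; rewrite ltxx.
Qed.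

(** The hypotheses that 0 occurs in each list are what embeds each list in the
    list of sums. *)
Lemma sum_one_zero_others_negP (R : realType) (I K : finType) (a : I -> R[i])
    (b : K -> R[i]) :
  (exists i, a i = 0) -> (exists l, b l = 0) ->
  one_zero_others_neg (fun p : I * K => a p.1 + b p.2) <->
  one_zero_others_neg a /\ one_zero_others_neg b.
Proof.
move=> [i1 ai1] [l1 bl1]; split=> [[p0 _ neg]|[[i0 ai0 nega] [l0 bl0 negb]]].
  (* A vanishing sum can only be the distinguished one. *)
  have p0E : p0 = (i1, l1).
    apply/eqP; rewrite eq_sym; apply: contraTT isT => /neg /=.
    by rewrite ai1 bl1 addr0 ltxx.
  rewrite {}p0E in neg; split.
    exists i1 => // i ii1; have := neg (i, l1); rewrite /= bl1 addr0; apply.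
    by apply: contra_neq ii1 => -[].
  exists l1 => // l ll1; have := neg (i1, l); rewrite /= ai1 add0r; apply.
  by apply: contra_neq ll1 => -[].
exists (i0, l0) => [|[i l]]; first by rewrite /= ai0 bl0 addr0.
rewrite xpair_eqE negb_and raddfD /=.
have [-> /= ll0|/nega ai _] := eqVneq i i0.
  by rewrite ai0 add0r negb.
have [->|/negb bl] := eqVneq l l0; first by rewrite bl0 addr0.
by rewrite -[0]addr0 ltrD.
Qed.

(** * Jacobians of oscillator systems *)

Definition cos_weights (R : realType) (n : nat) (B : 'M[R]_n) (x : 'rV[R]_n) :
    'M[R]_n :=
  \matrix_(i, j) (B i j * cos (x 0 j - x 0 i)).

(** Writing the Jacobian as minus a graph Laplacian, with a full row sum on the
    diagonal, avoids excluding the index [i] from the sum. *)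
Lemma jacobian_matrix_laplacian (R : realType) (n : nat) (omega : R)
    (B : 'M[R]_n) (x : 'rV[R]_n) (i j : 'I_n) :
  jacobian_matrix (oscillator_field omega B) x i j =
  cos_weights B x i j - (\sum_k cos_weights B x i k) *+ (i == j).
Proof.
rewrite jacobian_matrix_oscillator_field; have [<-|ij] := eqVneq i j.
  rewrite mulr1n [in RHS](bigD1 i) //= opprD addrA subrr add0r; congr (- _).
  by apply: eq_bigr => k _; rewrite mxE.
by rewrite mulr0n subr0 mxE.
Qed.

Lemma eigenvalue0_jacobian (R : realType) (n : nat) (omega : R) (B : 'M[R]_n)
    (x : 'rV[R]_n) :
  (0 < n)%N ->
  eigenvalue (map_mx (real_complex R)
                (jacobian_matrix (oscillator_field omega B) x)) 0.
Proof.
move=> n_gt0; set J := jacobian_matrix _ x.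
have detJ : \det J = 0.
  (* The rows sum to zero, so the all-ones vector lies in the right kernel;
     [det0P] asks for a left kernel, hence the transpose. *)
  rewrite -det_tr; apply/eqP/det0P; exists (const_mx 1).
    apply/eqP => /rowP/(_ (Ordinal n_gt0)); rewrite !mxE.
    exact/eqP/oner_neq0.
  apply/rowP => i; rewrite !mxE.
  transitivity (\sum_j J i j).
    by apply: eq_bigr => j _; rewrite !mxE mul1r.
  rewrite (eq_bigr _ (fun j _ => jacobian_matrix_laplacian omega B x i j)).
  rewrite sumrB; apply/eqP; rewrite subr_eq0; apply/eqP.
  set s := \sum_j _; rewrite (bigD1 i) //= eqxx big1 ?addr0 // => j ji.
  by rewrite eq_sym (negbTE ji).
rewrite eigenvalue_root_char /root horner_coef0 char_poly_det det_map_mx detJ.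
by rewrite rmorph0 mulr0.
Qed.

Lemma sum_mxtens_index (V : nmodType) (m n : nat) (F : 'I_(m * n) -> V) :
  \sum_x F x = \sum_k \sum_j F (mxtens_index (k, j)).
Proof.
rewrite pair_big /= (reindex (@mxtens_index m n)) /=.
  by apply: eq_bigr => -[].
by exists (@mxtens_unindex m n) => x _; rewrite ?mxtens_indexK ?mxtens_unindexK.
Qed.

Lemma compose_state_index (R : realType) (N M : nat) (psi : 'rV[R]_N)
    (phi : 'rV[R]_M) (l : 'I_M) (i : 'I_N) :
  compose_state psi phi 0 (mxtens_index (l, i)) = psi 0 i + phi 0 l.
Proof. by apply: compose_stateE; rewrite /= mulnC. Qed.

(** A coupling of the multiplex joins two nodes of one layer, whose [phi] terms
    cancel, or two copies of one node, whose [psi] terms cancel. The function [h]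
    is the sine for the vector field and the cosine for its Jacobian. *)
Lemma kronecker_sum_coupling (R : realType) (h : R -> R) (N M : nat)
    (A : 'M[R]_N) (B : 'M[R]_M) (psi : 'rV[R]_N) (phi : 'rV[R]_M)
    (l k : 'I_M) (i j : 'I_N) :
  let theta := compose_state psi phi in
  let x := mxtens_index (l, i) in let y := mxtens_index (k, j) in
  kronecker_sum A B x y * h (theta 0 y - theta 0 x) =
  (A i j * h (psi 0 j - psi 0 i)) *+ (l == k) +
  (B l k * h (phi 0 k - phi 0 l)) *+ (i == j).
Proof.
rewrite /= kronecker_sumE !compose_state_index mulrDl !mulrnAl.
congr (_ + _).
  have [->|_] := eqVneq l k; rewrite ?mulr0n //.
  by rewrite opprD addrACA subrr addr0.
have [->|_] := eqVneq i j; rewrite ?mulr0n //.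
by rewrite opprD addrACA subrr add0r.
Qed.

(** The Kronecker-delta factors of a multiplex row sum collapse it to the sum of
    one intra-layer and one inter-layer row sum. *)
Lemma sum_kronecker_coupling (V : nmodType) (N M : nat) (f : 'I_N -> V)
    (g : 'I_M -> V) (l : 'I_M) (i : 'I_N) :
  \sum_k \sum_j (f j *+ (l == k) + g k *+ (i == j)) =
  \sum_j f j + \sum_k g k.
Proof.
under eq_bigr => k _ do rewrite big_split /=.
rewrite big_split /=; congr (_ + _).
  rewrite (bigD1 l) //= eqxx [X in _ + X]big1 ?addr0 // => k kl.
  by rewrite eq_sym (negbTE kl) big1.
apply: eq_bigr => k _; rewrite (bigD1 i) //= eqxx big1 ?addr0 // => j ji.
by rewrite eq_sym (negbTE ji).
Qed.

Lemma equilibrium_compose_state (R : realType) (N M : nat)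
    (omega1 omega2 : R) (A : 'M[R]_N) (B : 'M[R]_M) (psi : 'rV[R]_N)
    (phi : 'rV[R]_M) :
  equilibrium (oscillator_field omega1 A) psi ->
  equilibrium (oscillator_field omega2 B) phi ->
  equilibrium (oscillator_field (omega2 + omega1) (kronecker_sum A B))
    (compose_state psi phi).
Proof.
move=> /rowP psi_eq /rowP phi_eq; apply/rowP => x.
case: (mxtens_indexP x) => l i.
rewrite [LHS]mxE [RHS]mxE sum_mxtens_index.
under eq_bigr => k _ do under eq_bigr => j _ do rewrite kronecker_sum_coupling.
rewrite sum_kronecker_coupling [omega2 + _]addrC addrACA.
have := psi_eq i; have := phi_eq l; rewrite !mxE => -> ->.
exact: addr0.
Qed.

Lemma jacobian_matrix_kronecker_sum (R : realType) (N M : nat)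
    (omega omega1 omega2 : R) (A : 'M[R]_N) (B : 'M[R]_M) (psi : 'rV[R]_N)
    (phi : 'rV[R]_M) :
  jacobian_matrix (oscillator_field omega (kronecker_sum A B))
    (compose_state psi phi) =
  kronecker_sum (jacobian_matrix (oscillator_field omega1 A) psi)
    (jacobian_matrix (oscillator_field omega2 B) phi).
Proof.
apply/matrixP => x y.
case: (mxtens_indexP x) => l i; case: (mxtens_indexP y) => k j.
rewrite kronecker_sumE !jacobian_matrix_laplacian sum_mxtens_index.
have weightsE k' j' :
    cos_weights (kronecker_sum A B) (compose_state psi phi)
      (mxtens_index (l, i)) (mxtens_index (k', j')) =
    cos_weights A psi i j' *+ (l == k') + cos_weights B phi l k' *+ (i == j').
  by rewrite [LHS]mxE kronecker_sum_coupling !mxE.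
under eq_bigr => k' _ do under eq_bigr => j' _ do rewrite weightsE.
rewrite weightsE sum_kronecker_coupling (can_eq (@mxtens_indexK _ _)).
rewrite xpair_eqE; case: eqP => _; case: eqP => _ /=;
  rewrite ?mulr0n ?mulr1n ?subr0 ?addr0 ?add0r //.
by rewrite opprD addrACA.
Qed.

(** * Stability of the composed equilibrium *)

Lemma map_kronecker_sum (R : realType) (N M : nat) (A : 'M[R]_N)
    (B : 'M[R]_M) :
  map_mx (real_complex R) (kronecker_sum A B) =
  tensmx (map_mx (real_complex R) B) 1%:M +
  tensmx 1%:M (map_mx (real_complex R) A).
Proof.
rewrite /kronecker_sum /kronecker_product map_mxD !map_mxT !map_mx1.
by rewrite addrC.
Qed.

Theorem propositionV2 (R : realType) (N M : nat) (N_ge1 : (1 <= N)%N)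
    (M_ge1 : (1 <= M)%N) (A_intra : 'M[R]_N) (A_inter : 'M[R]_M)
    (A_intra_diag : forall i, A_intra i i = 0)
    (A_inter_diag : forall l, A_inter l l = 0)
    (omega_intra omega_inter : R) (psi : 'rV[R]_N) (phi : 'rV[R]_M)
    (psi_eq : equilibrium (oscillator_field omega_intra A_intra) psi)
    (phi_eq : equilibrium (oscillator_field omega_inter A_inter) phi) :
  linearly_stable
    (oscillator_field (omega_inter + omega_intra)
       (kronecker_sum A_intra A_inter))
    (compose_state psi phi)
  <->
  linearly_stable (oscillator_field omega_intra A_intra) psi /\
  linearly_stable (oscillator_field omega_inter A_inter) phi.
Proof.
have theta_eq := equilibrium_compose_state psi_eq phi_eq.
have stableE n (f : 'rV[R]_n -> 'rV[R]_n) x (I : finType) (d : I -> R[i]) :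
    equilibrium f x ->
    char_poly (map_mx (real_complex R) (jacobian_matrix f x)) =
      \prod_i ('X - (d i)%:P) ->
    linearly_stable f x <-> one_zero_others_neg d.
  move=> fx /stable_char_polyP <-.
  by split=> [[_ mult neg]|[mult neg]]; split.
have zeroE n omega (B : 'M[R]_n) x (d : 'I_n -> R[i]) : (0 < n)%N ->
    char_poly (map_mx (real_complex R)
      (jacobian_matrix (oscillator_field omega B) x)) =
      \prod_i ('X - (d i)%:P) ->
    exists i, d i = 0.
  move=> n_gt0 dE; have := eigenvalue0_jacobian omega B x n_gt0.
  rewrite eigenvalue_root_char dE /root horner_prod => /prodf_eq0[i _].
  by rewrite hornerXsubC sub0r oppr_eq0 => /eqP; exists i.
set f1 := oscillator_field omega_intra _ in psi_eq *.
set f2 := oscillator_field omega_inter _ in phi_eq *.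
have [a [b [aE bE]]] := char_poly_tens_sum_split
  (map_mx (real_complex R) (jacobian_matrix f1 psi))
  (map_mx (real_complex R) (jacobian_matrix f2 phi)) N_ge1 M_ge1.
rewrite -map_kronecker_sum.
rewrite -(jacobian_matrix_kronecker_sum (omega_inter + omega_intra)) => abE.
rewrite (stableE _ _ _ _ _ theta_eq abE).
rewrite (stableE _ _ _ _ _ psi_eq aE) (stableE _ _ _ _ _ phi_eq bE).
exact: sum_one_zero_others_negP (zeroE _ _ _ _ _ N_ge1 aE)
  (zeroE _ _ _ _ _ M_ge1 bE).
Qed.
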